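(* Let $\mathbb{F}$ be a finite field, let $k,d$ be positive integers, and let $C$ be an integer with $0\le C\leq \frac{k}{2}-1$. If $S\subset \mathbb{F}^{d}$ is $(k,k+C)$-subspace evasive, then $$|S|\leq 4k|\mathbb{F}|^{\frac{d}{\lfloor k/(2(C+1))\rfloor}}.$$
   Context: For a finite field $\mathbb{F}$, positive integers $k\le d$ and a positive integer $c$, a set $S\subset\mathbb{F}^d$ is called $(k,c)$-subspace evasive if every $k$-dimensional affine subspace of $\mathbb{F}^d$ contains at most $c$ elements of $S$. *)

(* Defs.v *)
From HB Require Import structures.
From mathcomp Require Import all_boot all_order all_algebra.
From mathcomp Require Import reals exp.

Set Implicit Arguments.
Unset Strict Implicit.
Unset Printing Implicit Defensive.

Import Order.TTheory GRing.Theory Num.Theory.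
Local Open Scope ring_scope.

Definition is_affine_subspace (F : finFieldType) (d k : nat)
    (A : {set 'rV[F]_d}) : Prop :=
  exists (v : 'rV[F]_d) (U : {vspace 'rV[F]_d}),
    (\dim U = k)%N /\ A = [set v + u | u in U].

(* The standing conditions 0 < k, k <= d and 0 < c are not part of this
   predicate: results about it must assume or derive them. *)
Definition subspace_evasive (F : finFieldType) (d k c : nat)
    (S : {set 'rV[F]_d}) : Prop :=
  forall A : {set 'rV[F]_d}, is_affine_subspace k A -> (#|S :&: A| <= c)%N.

(* Main.v *)
Require Import Defs.
From HB Require Import structures.
From mathcomp Require Import all_boot all_order all_algebra.
From mathcomp Require Import reals exp zify lra.

Set Implicit Arguments.
Unset Strict Implicit.
Unset Printing Implicit Defensive.

Import Order.TTheory GRing.Theory Num.Theory.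
Local Open Scope ring_scope.

(** Put [m = k %/ (2 (C + 1))].  If [S] is large then, even after deleting few
    points, it has more [m]-subsets than there are vectors, so two distinct
    [m]-subsets have the same sum.  This is an affine dependency on at most
    [2 m] points: their union together with any flat spans one dimension less
    than expected.  Collecting [C] such dependencies on disjoint supports uses
    at most [k] points; completing them to [k + C + 1] points of [S] gives a
    set lying in a flat of dimension [k]. *)

Lemma expn_sub_leq_ffact (n m : nat) : ((n - m) ^ m <= n ^_ m)%N.
Proof.
elim: m n => [|m IH] [|n] //; first by rewrite sub0n exp0n.
by rewrite subSS ffactSS expnS leq_mul // leqW // leq_subr.
Qed.

Lemma fact_leq_expn (m : nat) : (m`! <= m ^ m)%N.
Proof.
elim: m => [//|m IH]; rewrite factS expnS leq_mul //.
by apply: (leq_trans IH); case: m {IH} => [//|m]; rewrite leq_exp2r.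
Qed.

Lemma exists_supspace_dim (K : fieldType) (V : vectType K) (U : {vspace V})
    (k : nat) :
  (\dim U <= k)%N -> (k <= \dim {:V})%N ->
  exists2 W : {vspace V}, (U <= W)%VS & \dim W = k.
Proof.
move=> leUk lek.
pose X := take (k - \dim U) (vbasis U^C).
have sX : size X = (k - \dim U)%N.
  by rewrite size_take size_tuple dimv_compl; case: ltnP; lia.
have freeX : free X.
  have := basis_free (vbasisP U^C).
  by rewrite -{1}(cat_take_drop (k - \dim U) (vbasis U^C)) => /catl_free.
have sub : (<<X>> <= U^C)%VS.
  by apply/span_subvP => v /mem_take; apply: vbasis_mem.
exists (U + <<X>>)%VS; first exact: addvSl.
rewrite dimv_disjoint_sum; first by rewrite (eqP freeX) sX subnKC.
by apply/eqP; rewrite -subv0 -(capv_compl U) capvS.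
Qed.

Section Flats.
Variables (F : finFieldType) (d : nat).
Implicit Types (S T A B D : {set 'rV[F]_d}) (U : {vspace 'rV[F]_d}).

(** This is the direction space of the affine hull of [v] and the points of [D]. *)
Definition translates_span (v : 'rV[F]_d) D : {vspace 'rV[F]_d} :=
  <<[seq y - v | y <- enum D]>>%VS.

Lemma mem_translates_span v D x : x \in D -> x - v \in translates_span v D.
Proof. by move=> xD; apply: memv_span; apply: map_f; rewrite mem_enum. Qed.

Lemma dim_translates_span v D : (\dim (translates_span v D) <= #|D|)%N.
Proof. by rewrite (leq_trans (dim_span _)) // size_map -cardE. Qed.

(** Pigeonhole on subset sums: the number of [m]-subsets is the falling factorial of [#|S|] divided
    by [m!], hence at least [(#|S| - m) ^ m / m ^ m], which exceeds the number of vectors. *)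
Lemma equal_sum_subsets S (m : nat) :
  (m ^ m * #|F| ^ d < (#|S| - m) ^ m)%N ->
  exists A B, [/\ A \subset S, B \subset S, A != B,
    #|A| = m /\ #|B| = m & \sum_(y in A) y = \sum_(y in B) y].
Proof.
move=> big.
pose P := [set A : {set 'rV[F]_d} | A \subset S & #|A| == m].
have cardP : (#|F| ^ d < #|P|)%N.
  rewrite cards_draws -(ltn_pmul2r (fact_gt0 m)) bin_ffact.
  apply: leq_trans (expn_sub_leq_ffact _ _); apply: leq_ltn_trans big.
  by rewrite mulnC leq_mul2r fact_leq_expn orbT.
pose f A := \sum_(y in A) y.
have : ~~ dinjectiveb f (mem P).
  apply: contraL cardP => /dinjectiveP inj; rewrite -leqNgt.
  rewrite -(card_in_imset inj) (leq_trans (max_card _)) //.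
  by rewrite card_mx mul1n.
case/dinjectivePn=> A; rewrite inE => /andP[AS /eqP cA].
case=> B; rewrite !inE => /andP[nBA /andP[BS /eqP cB]] eqf.
by exists A, B; split; rewrite // eq_sym.
Qed.

(** Equal cardinalities let the equality of sums survive translation by [- v]; since [x] occurs on
    one side only, the relation can be solved for [x - v]. *)
Lemma equal_sum_mem_span v A B x :
  #|A| = #|B| -> \sum_(y in A) y = \sum_(y in B) y -> x \in A -> x \notin B ->
  x - v \in translates_span v ((A :|: B) :\ x).
Proof.
move=> cAB eqAB xA xB.
have : \sum_(y in A) (y - v) = \sum_(y in B) (y - v).
  by rewrite !sumrB !sumr_const eqAB cAB.
rewrite (bigD1 x) //= => /(canRL (addrK _)) ->.
apply: memvB; apply: memv_suml => y.
  move=> yB; apply: mem_translates_span; rewrite !inE yB orbT andbT.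
  by apply: contraNneq xB => <-.
by case/andP=> yA yx; apply: mem_translates_span; rewrite !inE yx yA.
Qed.

(** The equal-sum pair is sought outside [T], so all [#|D|] points of its union are new, while [D]
    without [x] already spans [x - v]: at most [#|D| - 1] dimensions are added. *)
Lemma add_dependency S T U v (m : nat) :
  (m ^ m * #|F| ^ d < (#|S :\: T| - m) ^ m)%N ->
  T \subset S -> (forall x, x \in T -> x - v \in U) ->
  exists T' U', [/\ T' \subset S, (#|T'| <= #|T| + 2 * m)%N,
    (forall x, x \in T' -> x - v \in U') &
    (\dim U' + #|T| < \dim U + #|T'|)%N].
Proof.
move=> /equal_sum_subsets[A [B [AS BS nAB [cA cB] eqAB]]] TS TU.
have [x xA xB] : exists2 x, x \in A & x \notin B.
  apply/subsetPn; apply: contra nAB => AB.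
  by rewrite eqEcard AB cA cB leqnn.
pose D := A :|: B; pose W := translates_span v (D :\ x).
have xD : x \in D by rewrite inE xA.
have DS : D \subset S :\: T by rewrite subUset AS BS.
have TD0 : T :&: D = set0.
  apply/setP=> y; rewrite !inE; apply/negP=> /andP[yT yD].
  have /(subsetP DS) : y \in D by rewrite inE.
  by rewrite inE yT.
have cTD : #|T :|: D| = (#|T| + #|D|)%N by rewrite cardsU TD0 cards0 subn0.
have cD : (#|D| <= 2 * m)%N.
  by rewrite (leq_trans (leq_card_setU A B)) // cA cB mul2n addnn.
exists (T :|: D), (U + W)%VS; split.
- by rewrite subUset TS (subset_trans DS) // subsetDl.
- by rewrite cTD leq_add2l.
- move=> y; rewrite inE => /orP[/TU|yD].
    exact: (subvP (addvSl U W)).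
  apply: (subvP (addvSr U W)); have [->|yx] := eqVneq y x.
    by apply: equal_sum_mem_span; rewrite // cA cB.
  by apply: mem_translates_span; rewrite !inE yx -in_setU.
- have := (dim_translates_span v (D :\ x)); rewrite -/W => dW.
  have := dimv_add_leqif U W => -[dUW _].
  by move: (cardsD1 x D); rewrite xD cTD; lia.
Qed.

(** Each round raises the excess of [#|T|] over [\dim U] by at least one. The number [n] is a budget
    for all points that the rounds remove from [S]. *)
Lemma collect_dependencies S (m n j : nat) :
  (m ^ m * #|F| ^ d < (#|S| - n) ^ m)%N -> (0 < #|S|)%N ->
  (0 < m)%N -> (m * (2 * j) <= n)%N ->
  exists T U v, [/\ T \subset S, (#|T| <= 1 + m * (2 * j))%N,
    (forall x, x \in T -> x - v \in U) & (\dim U + j < #|T|)%N].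
Proof.
move=> big /card_gt0P[v vS] m0; elim: j => [|j IH] jn.
  exists [set v], 0%VS, v; split; rewrite ?cards1 ?sub1set ?dimv0 //.
  by move=> x /set1P->; rewrite subrr mem0v.
rewrite mulnS mulnDr in jn *.
have [|T [U [w [TS cT TU dU]]]] := IH; first by lia.
(* Removing [T] and then [m] more costs at most [1 + 2mj + m] points, and [0 < m] absorbs the base
   point: this is at most [2m(j + 1)]. *)
have bigD : (m ^ m * #|F| ^ d < (#|S :\: T| - m) ^ m)%N.
  by apply: (leq_trans big); rewrite leq_exp2r // cardsDS //; lia.
have [T' [U' [T'S cT' TU' dU']]] := add_dependency bigD TS TU.
by exists T', U', w; split=> //; lia.
Qed.

Lemma subspace_evasive_card_bound S (k C m : nat) :
  (k <= d)%N -> (0 < m)%N -> (m * (2 * (C + 1)) <= k)%N ->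
  (2 * k < #|S|)%N ->
  subspace_evasive k (k + C) S ->
  ((#|S| - 2 * k) ^ m <= m ^ m * #|F| ^ d)%N.
Proof.
move=> kd m0 mk Sk evS; rewrite leqNgt; apply/negP => big.
have [|||T [U [v [TS cT TU dU]]]] :=
  @collect_dependencies S m (2 * k) C big; [lia..|].
have Cm : (C + 1 <= m * (C + 1))%N by rewrite leq_pmull.
(* Here [k + C + 1 <= 2k < #|S|], so enough points are left to complete [T]. *)
have : (k + C + 1 - #|T| <= #|S :\: T|)%N by rewrite cardsDS //; lia.
case/card_geqP=> s [us ss sS].
pose E := [set x in s].
have cE : #|E| = (k + C + 1 - #|T|)%N by rewrite cardsE (card_uniqP us).
(* The excess of [T] is at least [C + 1], so adding [k + C + 1 - #|T|] points keeps the dimension at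
   most [k]. *)
have [||W UW dW] := @exists_supspace_dim _ _ (U + translates_span v E)%VS k.
- have [dUE _] := dimv_add_leqif U (translates_span v E).
  by have := dim_translates_span v E; lia.
- by rewrite dimvf /dim /= mul1n.
have /evS : is_affine_subspace k [set v + u | u in W] by exists v, W.
apply/negP; rewrite -ltnNge.
have sub : T :|: E \subset S :&: [set v + u | u in W].
  apply/subsetP=> x xTE; rewrite inE; apply/andP; split.
    case/setUP: xTE => [/(subsetP TS)//|]; rewrite inE => /sS.
    by case/setDP.
  apply/imsetP; exists (x - v); last by rewrite addrC subrK.
  apply: (subvP UW); case/setUP: xTE => [/TU|xE].
    exact: (subvP (addvSl _ _)).
  by apply: (subvP (addvSr _ _)); apply: mem_translates_span.
apply: leq_trans (subset_leq_card sub).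
have TE0 : T :&: E = set0.
  apply/setP=> y; rewrite !inE; apply/negP=> /andP[yT /sS].
  by rewrite inE yT.
by rewrite cardsU TE0 cards0 cE; lia.
Qed.

End Flats.

Theorem theorem1p2 (R : realType) (F : finFieldType) (k d C : nat)
    (S : {set 'rV[F]_d})
    (hk : (0 < k)%N) (hd : (0 < d)%N) (hkd : (k <= d)%N)
    (hC : C%:R <= k%:R / 2 - 1 :> R)
    (hS : subspace_evasive k (k + C) S) :
  #|S|%:R <= 4 * k%:R * #|F|%:R `^ (d%:R / (k %/ (2 * (C + 1)))%N%:R) :> R.
Proof.
have kC : (2 * (C + 1) <= k)%N.
  by rewrite -(ler_nat R) natrM natrD; lra.
set m := (k %/ (2 * (C + 1)))%N.
have m0 : (0 < m)%N by rewrite divn_gt0 // addn1.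
have mk : (m * (2 * (C + 1)) <= k)%N by apply: leq_divM.
have lemk : (m <= k)%N by apply: leq_trans mk; rewrite leq_pmulr // addn1.
set a := _ `^ _.
have q1 : 1 <= #|F|%:R :> R by rewrite ler1n (cardD1 0) inE.
have a1 : 1 <= a by rewrite -(powRr0 #|F|%:R) ler_powR // divr_ge0.
have am : a ^+ m = #|F|%:R ^+ d.
  rewrite -powR_mulrn ?powR_ge0 // -powRrM divfK ?pnatr_eq0 -?lt0n //.
  by rewrite powR_mulrn.
(* If [#|S| > 4ka], then [a >= 1] and [m <= k] give [#|S| - 2k > 2ka >= ma]; the [m]-th power of
   this contradicts [subspace_evasive_card_bound]. *)
rewrite leNgt; apply/negP => big.
have k1 : 1 <= k%:R :> R by rewrite ler1n.
have ka : k%:R <= k%:R * a by rewrite ler_peMr.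
have Sk : (2 * k < #|S|)%N.
  by rewrite -(ltr_nat R) natrM; lra.
have := subspace_evasive_card_bound hkd m0 mk Sk hS.
apply/negP; rewrite -ltnNge -(ltr_nat R) natrM !natrX -am -exprMn.
rewrite ltrXn2r -?lt0n ?m0 //; first by rewrite mulr_ge0 // (le_trans ler01).
rewrite natrB 1?ltnW // natrM.
have : m%:R * a <= k%:R * a.
  by rewrite ler_wpM2r ?ler_nat // (le_trans ler01).
by lra.
Qed.
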